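(* Let $\mathbf P\in\mathcal P$ and $\mathbf Q\in\mathcal Q$ with $\lambda_{\mathbf{PQ}}\neq0$, and suppose $(\mathbf P\vartriangleright\mathbf Q)\vdash\mathcal R$ is nonzero. Then the expected mean square for $(\mathbf P\vartriangleright\mathbf Q)\vdash\mathcal R$ is $\xi_{\mathbf P}+r\lambda_{\mathbf{PQ}}\eta_{\mathbf Q}$.
   Context: Setting (chain of two randomizations). $\Omega,\Upsilon,\Gamma$ are finite sets, $f\colon\Omega\to\Upsilon$ and $h\colon\Upsilon\to\Gamma$ are surjective maps, and $f$ is equireplicate: every element of $\Upsilon$ has exactly $r$ preimages. $\mathbf X_f$ is the $\Omega\times\Upsilon$ matrix with $(\omega,\upsilon)$-entry $1$ if $f(\omega)=\upsilon$ and $0$ otherwise; $\mathbf X_h$ is the analogous $\Upsilon\times\Gamma$ matrix; $\mathbf D_h=\mathbf X_h'\mathbf X_h$. Primes denote transposes. A transitive permutation group $G$ on a finite set $S$ is stratifiable if the symmetric $0$-$1$ matrices of its symmetrized orbits on $S\times S$ all commute; the orthogonal projectors onto their common eigenspaces (strata) are its stratum projectors. $\mathcal P$ is the set of stratum projectors ($\Omega\times\Omega$ nonzero symmetric, mutually orthogonal idempotents summing to $\mathbf I_\Omega$) of a transitive stratifiable group $G_1$ on $\Omega$. $\mathcal Q$ arises from the stratum projectors $\mathbf Q_\Upsilon$ ($\Upsilon\times\Upsilon$, summing to $\mathbf I_\Upsilon$) of a transitive stratifiable group $G_2$ on $\Upsilon$ (or from a refinement in which some of these are replaced by mutually orthogonal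 nonzero symmetric sub-idempotents summing to them, all pieces keeping the same coefficient $\eta$): each $\mathbf Q_\Upsilon$ is replaced by the $\Omega\times\Omega$ matrix $\mathbf Q=r^{-1}\mathbf X_f\mathbf Q_\Upsilon\mathbf X_f'$. These are mutually orthogonal symmetric idempotents with sum $\mathbf I_{\mathcal Q}=r^{-1}\mathbf X_f\mathbf X_f'$. $\mathcal R$ arises from a set of nonzero symmetric, mutually orthogonal $\Upsilon\times\Upsilon$ idempotents $\mathbf R_\Upsilon$ with sum $\mathbf X_h\mathbf D_h^{-1}\mathbf X_h'$, each replaced by $\mathbf R=r^{-1}\mathbf X_f\mathbf R_\Upsilon\mathbf X_f'$; put $\mathbf I_{\mathcal R}=\sum_{\mathbf R\in\mathcal R}\mathbf R$. Model. $\mathbf Y=\mathbf Z+\mathbf X_f\mathbf W+\mathbf X_f\mathbf X_h\boldsymbol\tau$, where $\boldsymbol\tau\in\mathbb R^\Gamma$ is a fixed vector, $\mathbf Z$ (indexed by $\Omega$) and $\mathbf W$ (indexed by $\Upsilon$) are independent random vectors with mean zero, $\operatorname{Cov}(\mathbf Z)=\sum_{\mathbf P}\xi_{\mathbf P}\mathbf P$ and $\operatorname{Cov}(\mathbf W)=\sum\eta_{\mathbf Q}\mathbf Q_\Upsilon$ with $\xi_{\mathbf P},\eta_{\mathbf Q}\ge 0$. Thus $\operatorname E(\mathbf Y)=\mathbf X_f\mathbf X_h\boldsymbol\tau$ and $\operatorname{Cov}(\mathbf Y)=\mathbf V=\sum_{\mathbf P\in\mathcal P}\xi_{\mathbf P}\mathbf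 P+r\sum_{\mathbf Q\in\mathcal Q}\eta_{\mathbf Q}\mathbf Q$. Structure balance (assumed). $\mathcal Q$ is structure balanced in relation to $\mathcal P$: there are scalars $\lambda_{\mathbf{PQ}}$ with $\mathbf Q\mathbf P\mathbf I_{\mathcal Q}=\lambda_{\mathbf{PQ}}\mathbf Q$ for all $\mathbf P\in\mathcal P$, $\mathbf Q\in\mathcal Q$. $\mathcal R$ is structure balanced in relation to $\mathcal Q$: there are scalars $\lambda_{\mathbf{QR}}$ with $\mathbf R\mathbf Q\mathbf I_{\mathcal R}=\lambda_{\mathbf{QR}}\mathbf R$ for all $\mathbf Q\in\mathcal Q$, $\mathbf R\in\mathcal R$. Derived idempotents. If $\lambda_{\mathbf{PQ}}\ne0$, $\mathbf P\vartriangleright\mathbf Q=\lambda_{\mathbf{PQ}}^{-1}\mathbf{PQP}$. If also $\lambda_{\mathbf{QR}}\ne0$, $(\mathbf P\vartriangleright\mathbf Q)\vartriangleright\mathbf R=\lambda_{\mathbf{PQ}}^{-1}\lambda_{\mathbf{QR}}^{-1}\mathbf{PQRQP}$. Further, $(\mathbf P\vartriangleright\mathbf Q)\vdash\mathcal R=\mathbf P\vartriangleright\mathbf Q-\sum_{\mathbf R\in\mathcal R:\lambda_{\mathbf{QR}}\ne0}(\mathbf P\vartriangleright\mathbf Q)\vartriangleright\mathbf R$. The mean square for a nonzero symmetric idempotent $\mathbf A$ is $\mathbf Y'\mathbf A\mathbf Y/\operatorname{rank}(\mathbf A)$, and the expected mean square is its expectation. *)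

(* Defs.v *)
From HB Require Import structures.
From mathcomp Require Import all_boot all_order all_algebra all_fingroup.
From mathcomp Require Import all_classical all_reals all_analysis.

Set Implicit Arguments.
Unset Strict Implicit.
Unset Printing Implicit Defensive.

Import Order.TTheory GRing.Theory Num.Theory.
Local Open Scope ring_scope.

(* Rows and columns of a matrix "indexed by a finite set S" are numbered by
   'I_#|S| through enum_val / enum_rank. *)

Section Strata.
Context (R : realType) (S : finType).
Implicit Types (G : {group {perm S}}) (A E : 'M[R]_#|S|).

Definition transitive_perm_group G : bool :=
  [transitive G, on [set: S]%SET | 'P].

(* The orbit of (x, y) under the diagonal action of G on S x S. *)
Definition orbital G (x y : S) : {set S * S} :=
  [set ((g : {perm S}) x, (g : {perm S}) y) | g in G]%SET.

(* The symmetrized orbit of (x, y) is the union of its orbit and of the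
   transpose of its orbit; this is its 0-1 matrix. *)
Definition symm_orbit_mx G (x y : S) : 'M[R]_#|S| :=
  \matrix_(i, j) (((enum_val i, enum_val j) \in orbital G x y)
               || ((enum_val j, enum_val i) \in orbital G x y))%:R.

Definition stratifiable G : Prop :=
  forall x y x' y' : S,
    comm_mx (symm_orbit_mx G x y) (symm_orbit_mx G x' y').

(* Common eigenspace for the eigenvalues chi x y of the matrices
   symm_orbit_mx G x y. MathComp eigenspaces are row spaces (left
   eigenvectors); the matrices being symmetric, this makes no difference. *)
Definition common_eigenspace G (chi : S -> S -> R) : 'M[R]_#|S| :=
  (\bigcap_(p : S * S)
     eigenspace (symm_orbit_mx G p.1 p.2) (chi p.1 p.2))%MS.

Definition symm_idempotent A : Prop := A^T = A /\ A *m A = A.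

Definition mutually_orthogonal (I : finType) (F : I -> 'M[R]_#|S|) : Prop :=
  forall i j, i != j -> F i *m F j = 0.

Definition orth_projector_onto (W : 'M[R]_#|S|) E : Prop :=
  symm_idempotent E /\ (E == W)%MS.

Definition stratum_projector G E : Prop :=
  E != 0 /\ exists chi, orth_projector_onto (common_eigenspace G chi) E.

(* F enumerates, without repetition, the set of all stratum projectors of G. *)
Definition stratum_projectors G (I : finType) (F : I -> 'M[R]_#|S|) : Prop :=
  injective F /\ forall E, stratum_projector G E <-> exists i, E = F i.

(* Each F k is replaced by the pieces F' i with s i = k; a projector which is
   left alone has itself as its only piece. *)
Definition refinement (I J : finType) (F : I -> 'M[R]_#|S|)
    (s : J -> I) (F' : J -> 'M[R]_#|S|) : Prop :=
  [/\ forall j, F' j != 0 /\ symm_idempotent (F' j),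
      forall j, F (s j) *m F' j = F' j /\ F' j *m F (s j) = F' j,
      forall j j', s j = s j' -> j != j' -> F' j *m F' j' = 0 &
      forall i, F i = \sum_(j | s j == i) F' j].

(* {F_j} is structure balanced in relation to {E_i}, with efficiency factors
   lam i j. *)
Definition structure_balanced (I J : finType) (E : I -> 'M[R]_#|S|)
    (F : J -> 'M[R]_#|S|) (lam : I -> J -> R) : Prop :=
  forall i j, F j *m E i *m (\sum_j' F j') = lam i j *: F j.

End Strata.

Section Randomization.
Context (R : realType) (S T : finType).

Definition surjective (f : S -> T) : Prop := forall t, exists s, f s = t.

Definition equireplicate (f : S -> T) (r : nat) : Prop :=
  forall t, #|[set s | f s == t]%SET| = r.

Definition design_mx (f : S -> T) : 'M[R]_(#|S|, #|T|) :=
  \matrix_(i, j) (f (enum_val i) == enum_val j)%:R.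

Definition lift_mx (f : S -> T) (r : nat) (A : 'M[R]_#|T|) : 'M[R]_#|S| :=
  r%:R^-1 *: (design_mx f *m A *m (design_mx f)^T).

(* X (X' X)^-1 X' *)
Definition design_proj (f : S -> T) : 'M[R]_#|S| :=
  let X := design_mx f in X *m invmx (X^T *m X) *m X^T.

End Randomization.

Section DerivedIdempotents.
Context (R : realType) (n : nat).

Definition pertaining (lPQ : R) (P Q : 'M[R]_n) : 'M[R]_n :=
  lPQ^-1 *: (P *m Q *m P).

Definition pertaining2 (lPQ lQR : R) (P Q Rm : 'M[R]_n) : 'M[R]_n :=
  (lPQ^-1 * lQR^-1) *: (P *m Q *m Rm *m Q *m P).

Definition residual (lPQ : R) (P Q : 'M[R]_n) (K : finType)
    (lQR : K -> R) (Rm : K -> 'M[R]_n) : 'M[R]_n :=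
  pertaining lPQ P Q -
  \sum_(k | lQR k != 0) pertaining2 lPQ (lQR k) P Q (Rm k).

End DerivedIdempotents.

Section RandomVectors.
Context (R : realType) (d : measure_display) (T : measurableType d)
  (Pr : probability T R).

Definition random_col (S : finType) (X : S -> {RV Pr >-> R}) (t : T) :
    'cV[R]_#|S| := \col_i X (enum_val i) t.

(* The sigma-algebra on the sample space generated by a random vector. *)
Definition sigma_of (S : finType) (X : S -> {RV Pr >-> R}) : set (set T) :=
  <<s [set A | exists s, preimage_set_system setT (X s) measurable A] >>%classic.

Definition independent_vectors (S S' : finType)
    (X : S -> {RV Pr >-> R}) (Y : S' -> {RV Pr >-> R}) : Prop :=
  forall A B : set T, sigma_of X A -> sigma_of Y B ->
    Pr (A `&` B)%classic = (Pr A * Pr B)%E.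

Definition mean_zero (S : finType) (X : S -> {RV Pr >-> R}) : Prop :=
  forall s, 'E_Pr[X s]%E = 0%E.

(* Square integrability is what makes the entries of Cov(X) meaningful. *)
Definition has_covariance_mx (S : finType) (X : S -> {RV Pr >-> R})
    (V : 'M[R]_#|S|) : Prop :=
  (forall s, (X s : T -> R) \in Lfun Pr 2%:E) /\
  (forall s s', covariance Pr (X s) (X s') =
                (V (enum_rank s) (enum_rank s'))%:E).

(* Y = Z + X_f W + X_f X_h tau *)
Definition response (Om Up Ga : finType) (f : Om -> Up) (h : Up -> Ga)
    (Z : Om -> {RV Pr >-> R}) (W : Up -> {RV Pr >-> R})
    (tau : 'cV[R]_#|Ga|) (t : T) : 'cV[R]_#|Om| :=
  random_col Z t + design_mx R f *m random_col W t
  + design_mx R f *m design_mx R h *m tau.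

Definition mean_square (n : nat) (A : 'M[R]_n) (Y : T -> 'cV[R]_n) (t : T) : R :=
  ((Y t)^T *m A *m Y t) 0 0 / (\rank A)%:R.

Definition expected_mean_square (n : nat) (A : 'M[R]_n)
    (Y : T -> 'cV[R]_n) : \bar R := 'E_Pr[mean_square A Y]%E.

End RandomVectors.

(* Main.v *)
Require Import Defs.
From HB Require Import structures.
From mathcomp Require Import all_boot all_order all_algebra all_fingroup.
From mathcomp Require Import all_classical all_reals all_analysis.
From mathcomp Require Import measurable_realfun spectral complex ring.

Set Implicit Arguments.
Unset Strict Implicit.
Unset Printing Implicit Defensive.

Import Order.TTheory GRing.Theory Num.Theory.
Local Open Scope ring_scope.

(** Up to the factor [lam_PQ^-1], the residual projector [A] equals [P N P],
    where [N] is the part of [Q] orthogonal to all the [R]'s. Structure balance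
    gives [Q P Q' = delta lam_PQ Q], hence [A] is a symmetric idempotent fixed
    by [P], killed by the other [P]'s and [Q]'s and by every [R], and
    [tr (A Q) = lam_PQ tr A]. As [A] kills the treatment means, [Y'AY] is a
    quadratic form in the centered vector [Z + X_f W], whose second moments are
    the entries of [V] because [Z] and [W] are independent; so its expectation
    is [tr (A V) = (xi_P + r lam_PQ eta_Q) rank A]. That the [Q]'s sum to the
    projector [I_Q], which [I_Q I_R = I_R] relies on, is the simultaneous
    diagonalization of the commuting symmetric orbit matrices. *)

(** * Symmetric matrices *)

(** Factor [A] through its rank as [col_base A *m row_base A]. Idempotence allows both factors to be
    cancelled, so the product in the other order is the identity of size [\rank A], and it has the
    same trace. *)
Lemma mxtrace_idem (F : fieldType) n (A : 'M[F]_n) :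
  A *m A = A -> \tr A = (\rank A)%:R.
Proof.
move=> idA; rewrite -[A in \tr A]mulmx_base mxtrace_mulC.
suff -> : row_base A *m col_base A = 1%:M by rewrite mxtrace1.
apply: (row_free_inj (row_base_free A)); rewrite mul1mx.
apply: (row_full_inj (col_base_full A)).
by rewrite mulmxA mulmxA mulmx_base -mulmxA mulmx_base.
Qed.

(** Each diagonal entry of [A *m A^T] is the sum of squares of a row. *)
Lemma mulmx_tr_eq0 (R : realDomainType) m n (A : 'M[R]_(m, n)) :
  A *m A^T = 0 -> A = 0.
Proof.
move=> AA0; apply/matrixP => i j; rewrite mxE.
have /eqP := congr1 (fun M : 'M[R]_m => M i i) AA0; rewrite !mxE.
under eq_bigr do rewrite mxE -expr2.
rewrite psumr_eq0 => [/allP/(_ j)|? _]; last exact: sqr_ge0.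
by rewrite mem_index_enum sqrf_eq0 => /(_ isT)/eqP.
Qed.

Lemma gram_unitmx (R : realFieldType) m n (A : 'M[R]_(m, n)) :
  row_free A -> A *m A^T \in unitmx.
Proof.
move=> freeA; rewrite -row_free_unit -kermx_eq0.
apply/eqP/(row_free_inj freeA)/eqP; rewrite mul0mx; apply/eqP/mulmx_tr_eq0.
by rewrite trmx_mul mulmxA -(mulmxA _ A) mulmx_ker mul0mx.
Qed.

(** The witness is the classical projector [B^T (B B^T)^-1 B], with [B] a row basis of [U]; its Gram
    matrix is invertible by [gram_unitmx]. *)
Lemma orth_proj_exists (R : realFieldType) n (U : 'M[R]_n) :
  exists E : 'M[R]_n, [/\ E^T = E, E *m E = E & (E == U)%MS].
Proof.
have [B [uB UB]] : exists B : 'M[R]_(\rank U, n),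
    B *m B^T \in unitmx /\ (B :=: U)%MS.
  exists (row_base U); split; last exact: eq_row_base.
  exact/gram_unitmx/row_base_free.
pose G : 'M[R]_(\rank U) := invmx (B *m B^T); exists (B^T *m G *m B).
have BE : B *m (B^T *m G *m B) = B by rewrite !mulmxA mulmxV ?mul1mx.
split.
- by rewrite /G !trmx_mul trmxK trmx_inv trmx_mul trmxK; rewrite mulmxA.
- by have := congr1 (mulmx (B^T *m G)) BE; rewrite !mulmxA.
- apply/andP; split; first by rewrite (submx_trans (submxMl _ B)) ?UB.
  by rewrite -UB; have := submxMl B (B^T *m G *m B); rewrite BE.
Qed.

(** Over the complex extension the matrix is hermitian, hence unitarily diagonalizable with real
    spectrum. Its minimal polynomial there divides a product of distinct linear factors with real
    roots, and this divisibility descends to [R]. *)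
Lemma symm_diagonalizable (R : rcfType) n (M : 'M[R]_n) :
  M^T = M -> diagonalizable M.
Proof.
case: n M => [|n] M symM; first by rewrite thinmx0; apply: diagonalizable0.
pose f := real_complex R; pose A := map_mx f M.
have rA : A \is a realmx.
  by apply/mxOverP => i j; rewrite mxE; apply/complex_realP; exists (M i j).
have hA : A \is hermsymmx.
  apply: realsym_hermsym => //.
  by apply/is_hermitianmxP; rewrite expr0 scale1r map_mx_id // map_trmx symM.
have /mxOverP rd := hermitian_spectral_diag_real hA.
have /orthomx_spectralP defA := hermitian_normalmx hA.
set d := spectral_diag A in rd defA.
set rs := [seq complex.Re (d 0 i) | i <- enum 'I_n.+1].
apply/diagonalizableP; exists (undup rs); first exact: undup_uniq.
rewrite -(dvdp_map f) -mxminpoly_map -/A defA.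
have uP := spectral_unit A.
rewrite -mxpoly.conjVmx // mxminpoly_uconj ?unitmx_inv // mxminpoly_diag.
rewrite rmorph_prod /=; have f_inj : injective f by exact: fmorph_inj.
have -> : \prod_(r <- undup rs) map_poly f ('X - r%:P) =
    \prod_(r <- map f (undup rs)) ('X - r%:P).
  rewrite big_map; apply: eq_bigr => r _.
  by rewrite rmorphB /= map_polyX map_polyC.
rewrite -undup_map_inj //.
suff -> : map f rs = [seq d 0 i | i <- enum 'I_n.+1] by exact: dvdpp.
rewrite -map_comp; apply: eq_map => i /=.
by have /complex_realP[x ->] := rd 0 i.
Qed.

(** * Strata *)

Section Strata.
Context (R : realType) (S : finType).
Implicit Types (G : {group {perm S}}) (E : 'M[R]_#|S|).

(** An orthogonal projector is determined by its range: equal row spaces give [E *m E' = E] and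
    [E' *m E = E'], and transposing the second identity yields [E *m E' = E']. *)
Lemma symm_idempotent_eqmx E E' :
  symm_idempotent E -> symm_idempotent E' -> (E == E')%MS -> E = E'.
Proof.
move=> [sE iE] [sE' iE'] /andP[/submxP[D defE] /submxP[D' defE']].
have EE' : E *m E' = E by rewrite {1}defE -mulmxA iE'.
have E'E : E' *m E = E' by rewrite {1}defE' -mulmxA iE.
by rewrite -[LHS]EE' -[RHS]sE' -[in RHS]E'E trmx_mul sE sE'.
Qed.

Lemma trmx_symm_orbit_mx G x y :
  (symm_orbit_mx R G x y)^T = symm_orbit_mx R G x y.
Proof. by apply/matrixP => i j; rewrite !mxE orbC. Qed.

Lemma common_eigenspaceP G (chi : S -> S -> R) m (V : 'M[R]_(m, #|S|)) :
  (V <= common_eigenspace G chi)%MS <->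
  forall x y, V *m symm_orbit_mx R G x y = chi x y *: V.
Proof.
split=> [/sub_bigcapmxP sV x y | eV].
  by apply/eigenspaceP; apply: (sV (x, y)).
by apply/sub_bigcapmxP => p _; apply/eigenspaceP/eV.
Qed.

(** If the two eigenvalue systems coincide, the projectors are equal, against injectivity. Otherwise
    some orbit matrix [M] has different eigenvalues on the two strata; since [M] is symmetric,
    evaluating [F i *m M *m F j] from either side forces [F i *m F j = 0]. *)
Lemma strata_orthogonal G (I : finType) (F : I -> 'M[R]_#|S|) :
  stratum_projectors G F -> mutually_orthogonal F.
Proof.
move=> [injF strF] i j neq_ij.
have [_ [chi [iFi Ui]]] : stratum_projector G (F i) by apply/strF; exists i.
have [_ [psi [iFj Uj]]] : stratum_projector G (F j) by apply/strF; exists j.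
have /andP[/common_eigenspaceP eFi _] := Ui.
have /andP[/common_eigenspaceP eFj _] := Uj.
have [eq_chi|] := pselect (chi = psi).
  move: neq_ij; rewrite (injF i j) ?eqxx //; apply: symm_idempotent_eqmx => //.
  apply/eqmxP/(eqmx_trans (eqmxP Ui)); rewrite eq_chi.
  exact/eqmx_sym/eqmxP.
move=> neq_chi; have [[x y] /= neq_xy] : exists p, chi p.1 p.2 != psi p.1 p.2.
  apply: contra_notP neq_chi => nex; apply/funext => x; apply/funext => y.
  by apply/eqP; apply: contra_notT nex => neq; exists (x, y).
have [sFj _] := iFj; set M := symm_orbit_mx R G x y.
have : chi x y *: (F i *m F j) = psi x y *: (F i *m F j).
  rewrite scalemxAl -eFi -mulmxA -/M -{1}sFj -[M]trmx_symm_orbit_mx -trmx_mul.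
  by rewrite eFj linearZ /= sFj -scalemxAr.
move/eqP; rewrite -subr_eq0 -scalerBl scaler_eq0 subr_eq0 (negPf neq_xy) /=.
by move/eqP.
Qed.

(** In a basis [V] that diagonalizes all orbit matrices at once, each row is a common eigenvector.
    It therefore lies in one stratum, and by orthogonality the sum of the projectors fixes it. *)
Lemma strata_sum G (I : finType) (F : I -> 'M[R]_#|S|) :
  stratifiable R G -> stratum_projectors G F -> \sum_i F i = 1%:M.
Proof.
move=> stratG strF; have oF := strata_orthogonal strF.
have [V uV /allP dV] : codiagonalizable
    [seq symm_orbit_mx R G p.1 p.2 | p <- enum {: S * S}].
  apply/codiagonalizableP; split.
    by move=> _ _ /mapP[p _ ->] /mapP[q _ ->]; apply: stratG.
  by move=> _ /mapP[p _ ->]; apply/symm_diagonalizable/trmx_symm_orbit_mx.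
suff VF : V *m (\sum_i F i) = V.
  by rewrite -[LHS](mulKmx uV) VF mulVmx.
apply/row_matrixP => k; rewrite row_mul.
(* The [k]-th diagonal entry of the conjugated orbit matrix is its eigenvalue on row [k] of [V]. *)
pose chi x y := mxpoly.conjmx V (symm_orbit_mx R G x y) k k.
have [E [sE iE UE]] := orth_proj_exists (common_eigenspace G chi).
have kE : row k V *m E = row k V.
  have /submxP[D ->] : (row k V <= E)%MS; last by rewrite -mulmxA iE.
  rewrite (eqmxP UE); apply/common_eigenspaceP => x y.
  set M := symm_orbit_mx R G x y.
  have /diagonalizable_forPex[D] : diagonalizable_for V M.
    by apply: dV; apply/mapP; exists (x, y); rewrite ?mem_enum.
  move=> /eqP VM; rewrite -row_mul.
  have -> : V *m M = diag_mx D *m V by rewrite -VM mxpoly.conjumx // mulmxKV.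
  by rewrite row_mul row_diag_mx -scalemxAl -rowE /chi -/M VM mxE eqxx mulr1n.
have [i defE] : exists i, E = F i.
  apply: (proj1 (proj2 strF E)); split; last by exists chi.
  (* [E] is nonzero because it fixes a row of the invertible matrix [V]. *)
  apply: contra_eqN (congr1 (mulmx^~ (invmx V)) kE) => /eqP ->.
  rewrite mulmx0 mul0mx -row_mul mulmxV //; apply/eqP => /rowP/(_ k)/eqP.
  by rewrite !mxE eqxx eq_sym pnatr_eq0.
rewrite -kE defE -mulmxA mulmx_sumr (bigD1 i) //= big1 ?addr0.
  by rewrite -defE iE.
by move=> j /negPf neq_ji; apply: oF; rewrite eq_sym neq_ji.
Qed.

End Strata.

(** * Refined families of projectors *)

Section Refinement.
Context (R : realType) (S I J : finType).
Variables (F : I -> 'M[R]_#|S|) (s : J -> I) (F' : J -> 'M[R]_#|S|).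
Hypothesis refF : refinement F s F'.

(** Pieces with distinct parents are orthogonal because each piece absorbs its parent, so that the
    product of the two parents can be inserted between them. *)
Lemma refinement_orthogonal : mutually_orthogonal F -> mutually_orthogonal F'.
Proof.
move=> oF j j' neq_jj'; have [_ absF oF' _] := refF.
have [/oF'->//|neq_s] := eqVneq (s j) (s j').
rewrite -(proj2 (absF j)) -(proj1 (absF j')) mulmxA -(mulmxA (F' j)).
by rewrite oF // mulmx0 mul0mx.
Qed.

Lemma refinement_sum : \sum_j F' j = \sum_i F i.
Proof.
have [_ _ _ sumF] := refF.
by rewrite (partition_big s xpredT) //=; apply: eq_bigr => i _; rewrite sumF.
Qed.

End Refinement.

(** * Design matrices and structure balance *)

Section DesignMatrix.
Context (R : realType) (S T : finType).
Implicit Types (f : S -> T) (r : nat) (A B : 'M[R]_#|T|).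

Lemma design_mx_mulE f m (M : 'M[R]_(#|T|, m)) i j :
  (design_mx R f *m M) i j = M (enum_rank (f (enum_val i))) j.
Proof.
rewrite mxE (bigD1 (enum_rank (f (enum_val i)))) //= big1 => [|k neq_k].
  by rewrite mxE enum_rankK eqxx mul1r addr0.
rewrite mxE; case: eqP => [fk|]; last by rewrite mul0r.
by rewrite fk enum_valK eqxx in neq_k.
Qed.

(** Distinct columns of the design matrix have disjoint supports, and each column has one 1 per
    preimage. *)
Lemma design_gram f :
  (design_mx R f)^T *m design_mx R f =
  diag_mx (\row_j #|[set s | f s == enum_val j]%SET|%:R).
Proof.
apply/matrixP => i j; rewrite !mxE.
rewrite (reindex_onto enum_rank enum_val) /=; last first.
  by move=> k _; rewrite enum_valK.
under eq_bigl do rewrite enum_rankK eqxx.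
under eq_bigr do rewrite !mxE enum_rankK.
have [<-|neq_ij] := eqVneq i j.
  rewrite mulr1n -sum1_card natr_sum big_mkcond /=.
  rewrite [RHS]big_mkcond; apply: eq_bigr => s _; rewrite inE.
  by case: eqP; rewrite ?mulr1 ?mulr0.
rewrite big1 => [|s _]; first by rewrite mulr0n.
case: eqP => [->|]; last by rewrite mul0r.
by rewrite (inj_eq enum_val_inj) (negPf neq_ij) mulr0.
Qed.

Lemma design_gram_rep f r :
  equireplicate f r -> (design_mx R f)^T *m design_mx R f = r%:R%:M.
Proof.
move=> f_rep; rewrite design_gram -diag_const_mx; congr diag_mx.
by apply/rowP => j; rewrite !mxE f_rep.
Qed.

Lemma design_gram_unitmx f :
  surjective f -> (design_mx R f)^T *m design_mx R f \in unitmx.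
Proof.
move=> f_surj; rewrite design_gram unitmxE det_diag unitfE.
apply/prodf_neq0 => j _; rewrite mxE pnatr_eq0 -lt0n; apply/card_gt0P.
by have [s fs] := f_surj (enum_val j); exists s; rewrite inE fs.
Qed.

Lemma design_proj_mul f :
  surjective f -> design_proj R f *m design_mx R f = design_mx R f.
Proof.
by move=> f_surj; rewrite /design_proj -mulmxA mulmxKV // design_gram_unitmx.
Qed.

Lemma trmx_lift f r A : (lift_mx f r A)^T = lift_mx f r A^T.
Proof. by rewrite /lift_mx linearZ /= !trmx_mul trmxK mulmxA. Qed.

Lemma lift_mx_sum f r (I : finType) (F : I -> 'M[R]_#|T|) :
  lift_mx f r (\sum_i F i) = \sum_i lift_mx f r (F i).
Proof. by rewrite /lift_mx mulmx_sumr mulmx_suml scaler_sumr. Qed.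

Lemma lift_mx0 f r : lift_mx f r (0 : 'M[R]_#|T|) = 0.
Proof. by rewrite /lift_mx mulmx0 mul0mx scaler0. Qed.

Section Equireplicate.
Variables (f : S -> T) (r : nat).
Hypotheses (f_rep : equireplicate f r) (r_gt0 : (0 < r)%N).

Let r_neq0 : r%:R != 0 :> R. Proof. by rewrite pnatr_eq0 -lt0n. Qed.

(** The factor [r^-1] of the lift cancels the Gram matrix [r%:R%:M]: on the image of the design
    matrix, the lift of [A] acts as [A] does downstairs. Multiplicativity of the lift follows. *)
Lemma lift_mx_design A m (M : 'M[R]_(#|T|, m)) :
  lift_mx f r A *m (design_mx R f *m M) = design_mx R f *m (A *m M).
Proof.
rewrite /lift_mx -scalemxAl -!mulmxA (mulmxA _ (design_mx R f)).
rewrite (design_gram_rep f_rep) // mul_scalar_mx -!scalemxAr.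
by rewrite scalerA mulVf // scale1r.
Qed.

Lemma lift_mxM A B : lift_mx f r A *m lift_mx f r B = lift_mx f r (A *m B).
Proof.
by rewrite {2}/lift_mx -scalemxAr -mulmxA lift_mx_design /lift_mx !mulmxA.
Qed.

End Equireplicate.
End DesignMatrix.

Lemma orthogonal_sum_mul (R : pzSemiRingType) n (I : finType)
    (F : I -> 'M[R]_n) :
  (forall i, F i *m F i = F i) ->
  (forall i j, i != j -> F i *m F j = 0) ->
  forall i, (\sum_i' F i') *m F i = F i.
Proof.
move=> idF oF i; rewrite mulmx_suml (bigD1 i) //= idF big1 ?addr0 // => k.
exact: oF.
Qed.

(** * Algebra of the residual projector under structure balance *)

Section StructureBalance.
Context (R : realType) (n : nat) (IQ IR : finType).
Variables (P : 'M[R]_n) (Q : IQ -> 'M[R]_n) (Rm : IR -> 'M[R]_n).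
Variables (j : IQ) (lam : IQ -> R) (mu : IR -> R).
Hypotheses (P_sym : P^T = P) (P_idem : P *m P = P).
Hypotheses (Q_sym : (Q j)^T = Q j) (Q_idem : forall j', Q j' *m Q j' = Q j').
Hypothesis Q_orth : forall j1 j2, j1 != j2 -> Q j1 *m Q j2 = 0.
Hypotheses (R_sym : forall k, (Rm k)^T = Rm k).
Hypotheses (R_idem : forall k, Rm k *m Rm k = Rm k).
Hypothesis R_orth : forall k1 k2, k1 != k2 -> Rm k1 *m Rm k2 = 0.
Hypothesis R_sub_Q : (\sum_j' Q j') *m (\sum_k Rm k) = \sum_k Rm k.
Hypothesis balPQ : Q j *m P *m (\sum_j' Q j') = lam j *: Q j.
Hypothesis balQR : forall k, Rm k *m Q j *m (\sum_k' Rm k') = mu k *: Rm k.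
Hypothesis lam_neq0 : lam j != 0.

(** Writing [Q j'] as [(\sum_i' Q i') *m Q j'] exposes the balance identity, which leaves
    [Q j *m Q j'] to be evaluated by orthogonality. *)
Let QPQ j' : Q j *m P *m Q j' = (lam j * (j == j')%:R) *: Q j.
Proof.
rewrite -(orthogonal_sum_mul Q_idem Q_orth j') mulmxA balPQ -scalemxAl -scalerA.
congr (_ *: _).
by case: eqP => [<-|/eqP/Q_orth->]; rewrite ?Q_idem ?scale1r ?scale0r.
Qed.

Let RQR k k' : Rm k *m Q j *m Rm k' = (mu k * (k == k')%:R) *: Rm k.
Proof.
rewrite -(orthogonal_sum_mul R_idem R_orth k') mulmxA balQR -scalemxAl -scalerA.
congr (_ *: _).
by case: eqP => [<-|/eqP/R_orth->]; rewrite ?R_idem ?scale1r ?scale0r.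
Qed.

(** This is the residual of [Q j] itself: each summand is the projector of [Q j] pertaining to
    [Rm k]. Sandwiching it between two copies of [P] gives [A] up to a scalar. *)
Let N := Q j - \sum_(k | mu k != 0) (mu k)^-1 *: (Q j *m Rm k *m Q j).
Let A := residual (lam j) P (Q j) mu Rm.

Let A_def : A = (lam j)^-1 *: (P *m N *m P).
Proof.
rewrite /A /N /residual /pertaining mulmxBr mulmxBl scalerBr; congr (_ - _).
rewrite mulmx_sumr mulmx_suml scaler_sumr; apply: eq_bigr => k _.
by rewrite /pertaining2 -scalemxAr -scalemxAl scalerA !mulmxA.
Qed.

Let N_sym : N^T = N.
Proof.
rewrite /N linearB /= Q_sym linear_sum /=; congr (_ - _).
by apply: eq_bigr => k _; rewrite linearZ /= !trmx_mul Q_sym R_sym mulmxA.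
Qed.

Let QN : Q j *m N = N.
Proof.
rewrite /N mulmxBr Q_idem mulmx_sumr; congr (_ - _).
by apply: eq_bigr => k _; rewrite -scalemxAr !mulmxA Q_idem.
Qed.

Let NQ : N *m Q j = N.
Proof. by rewrite -{1}N_sym -{1}Q_sym -trmx_mul QN. Qed.

(** Balance turns each subtracted term with [mu k != 0] into [Q j *m Rm k], which cancels the
    matching term of [Q j *m \sum_k Rm k]. The remaining terms vanish one by one. *)
Let NR0 : N *m (\sum_k Rm k) = 0.
Proof.
rewrite /N mulmxBl mulmx_suml mulmx_sumr (bigID (fun k => mu k != 0)) /=.
rewrite [X in _ + X - _]big1 ?addr0 => [|k /negPn/eqP mu0].
  apply/eqP; rewrite subr_eq0; apply/eqP/eq_bigr => k mu_neq0.
  rewrite -scalemxAl -(mulmxA (Q j)) -mulmxA balQR -scalemxAr.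
  by rewrite scalerA mulVf ?scale1r.
(* For [mu k = 0], the product of [Rm k *m Q j] with its transpose is [Rm k *m Q j *m Rm k = 0], so
   [Rm k *m Q j] vanishes and so does its transpose. *)
apply: trmx_inj; rewrite trmx_mul R_sym Q_sym trmx0.
apply: mulmx_tr_eq0; rewrite trmx_mul R_sym Q_sym -mulmxA (mulmxA (Q j)).
by rewrite Q_idem mulmxA RQR mu0 mul0r scale0r.
Qed.

Let NN : N *m N = N.
Proof.
rewrite {2}/N mulmxBr NQ mulmx_sumr big1 ?subr0 // => k _.
rewrite -scalemxAr !mulmxA NQ.
rewrite -(orthogonal_sum_mul R_idem R_orth k) mulmxA.
by rewrite NR0 !mul0mx scaler0.
Qed.

Let NPQ j' : N *m P *m Q j' = (lam j * (j == j')%:R) *: N.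
Proof. by rewrite -{1}NQ -!mulmxA (mulmxA (Q j)) QPQ -scalemxAr NQ. Qed.

Let NPN : N *m P *m N = lam j *: N.
Proof. by rewrite -{2}QN mulmxA NPQ eqxx mulr1 -scalemxAl NN. Qed.

Lemma residual_sym : A^T = A.
Proof. by rewrite A_def linearZ /= !trmx_mul P_sym N_sym mulmxA. Qed.

Lemma residual_mulP : A *m P = A.
Proof. by rewrite A_def -scalemxAl -mulmxA P_idem. Qed.

(** The scalar [(lam j)^-1] in [A] compensates exactly the factor in [N *m P *m N = lam j *: N]. *)
Lemma residual_idem : A *m A = A.
Proof.
rewrite {2}A_def -scalemxAr !mulmxA residual_mulP A_def -!scalemxAl.
congr (_ *: _).
rewrite -(mulmxA P N P) -(mulmxA P) NPN -scalemxAr -scalemxAl.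
by rewrite scalerA mulVf ?scale1r ?mulmxA.
Qed.

Let AQ j' : A *m Q j' = (j == j')%:R *: (P *m N).
Proof.
rewrite A_def -scalemxAl -!mulmxA (mulmxA N) NPQ -scalemxAr scalerA mulrA.
by rewrite mulVf // mul1r.
Qed.

Lemma residual_mulQ j' : j' != j -> A *m Q j' = 0.
Proof. by rewrite AQ eq_sym => /negPf->; rewrite scale0r. Qed.

(** Here [A *m Q j] is [P *m N], whose trace is that of [P *m N *m P] by cyclicity and idempotence
    of [P]. *)
Lemma mxtrace_residual_mulQ : \tr (A *m Q j) = lam j * \tr A.
Proof.
rewrite AQ eqxx scale1r A_def mxtraceZ mulrA mulfV // mul1r.
by rewrite [in RHS]mxtrace_mulC mulmxA P_idem.
Qed.

(** By [R_sub_Q] the sum of the [Q]'s can be inserted after [P]; balance then collapses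
    [N *m P *m \sum_j' Q j'] to a multiple of [N], which kills the [R]'s. *)
Lemma residual_mulR : A *m (\sum_k Rm k) = 0.
Proof.
rewrite A_def -R_sub_Q -scalemxAl -!mulmxA.
rewrite -{1}NQ -(mulmxA N) (mulmxA (Q j)) (mulmxA (Q j *m P)) balPQ.
rewrite -scalemxAl -scalemxAr mulmxA NQ.
by rewrite NR0 scaler0 mulmx0 scaler0.
Qed.

End StructureBalance.

(** * Second moments *)

(** Independence identifies the joint law with the product law on rectangles, hence everywhere by
    uniqueness of the product measure; the claim is then a change of variables followed by
    Fubini. *)
Lemma integral_indep (R : realType) (d d1 d2 : measure_display)
    (T : measurableType d) (T1 : measurableType d1) (T2 : measurableType d2)
    (P : probability T R) (X : {RV P >-> T1}) (Y : {RV P >-> T2})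
    (F : T1 * T2 -> \bar R) :
  (forall A B, measurable A -> measurable B ->
     P (X @^-1` A `&` Y @^-1` B)%classic =
     (P (X @^-1` A)%classic * P (Y @^-1` B)%classic)%E) ->
  measurable_fun setT F -> P.-integrable setT (fun t => F (X t, Y t)) ->
  (\int[P]_t F (X t, Y t) =
   \int[distribution P X]_x \int[distribution P Y]_y F (x, y))%E.
Proof.
move=> indXY mF iF.
pose XY t := (X t, Y t).
pose m1 := distribution P X; pose m2 := distribution P Y.
have mXY : measurable_fun [set: T] XY by exact: measurable_fun_pair.
have iFXY : P.-integrable (XY @^-1` setT) (F \o XY) by rewrite preimage_setT.
pose m := pushforward P XY.
have mE A : measurable A -> m A = (m1 \x m2)%E A.
  move=> mA; symmetry; apply: (product_measure_unique (m' := m)) => //.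
have iF' : (m1 \x m2)%E.-integrable setT F.
  have := integrable_pushforward mXY mF iFXY measurableT.
  move=> /integrableP[_ h]; apply/integrableP; split => //.
  rewrite (eq_measure_integral m) // => A mA _.
  exact/esym/mE.
have -> : (\int[P]_t F (X t, Y t) = \int[m]_z F z)%E.
  by rewrite integral_pushforward // preimage_setT.
rewrite (eq_measure_integral (m1 \x m2)%E); last by move=> A mA _; exact: mE.
by rewrite -integral12_prod_meas1.
Qed.

Lemma expectation_mul_indep (R : realType) (d : measure_display)
    (T : measurableType d) (P : probability T R) (X Y : {RV P >-> R}) :
  (X : T -> R) \in Lfun P 1 -> (Y : T -> R) \in Lfun P 1 ->
  ((X : T -> R) * (Y : T -> R)) \in Lfun P 1 ->
  (forall A B, measurable A -> measurable B ->
     P (X @^-1` A `&` Y @^-1` B)%classic =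
     (P (X @^-1` A)%classic * P (Y @^-1` B)%classic)%E) ->
  ('E_P[(X : T -> R) * (Y : T -> R)] = 'E_P[X] * 'E_P[Y])%E.
Proof.
move=> X1 Y1 XY1 indXY.
have iX : P.-integrable setT (EFin \o X) by exact/Lfun1_integrable.
have iY : P.-integrable setT (EFin \o Y) by exact/Lfun1_integrable.
have iXY : P.-integrable setT (EFin \o (X \* Y)) by exact/Lfun1_integrable.
have iEX : (distribution P X).-integrable setT EFin.
  by apply: integrable_pushforward.
have iEY : (distribution P Y).-integrable setT EFin.
  by apply: integrable_pushforward.
have EY : (\int[distribution P Y]_y y%:E = 'E_P[Y])%E.
  by rewrite integral_distribution // unlock.
rewrite [in LHS]unlock.
rewrite (integral_indep (F := fun z : R * R => (z.1 * z.2)%:E)) //; last first.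
  by apply/measurable_EFinP; apply: measurable_funM.
under eq_integral => x _.
  under eq_integral do rewrite EFinM.
  (* The inner expectation is finite; exposing it as a real number lets it leave the outer integral
     as a scalar. *)
  rewrite integralZl // EY -(fineK (expectation_fin_num Y1)).
  over.
rewrite integralZr // fineK ?expectation_fin_num //.
by rewrite integral_distribution // unlock.
Qed.

Section SecondMoments.
Context (R : realType) (d : measure_display) (T : measurableType d)
  (Pr : probability T R).

Lemma Lfun2_Lfun1 (X : T -> R) : X \in Lfun Pr 2%:E -> X \in Lfun Pr 1.
Proof. by apply: Lfun_subset12; exact: fin_num_measure. Qed.

Lemma expectation_qform n (A V : 'M[R]_n) (U : 'I_n -> T -> R) :
  (forall a, U a \in Lfun Pr 2%:E) ->
  (forall a b, ('E_Pr[U a * U b] = (V a b)%:E)%E) ->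
  ('E_Pr[fun t => ((\col_a U a t)^T *m A *m (\col_a U a t)) ord0 ord0] =
   (\tr (A *m V))%:E)%E.
Proof.
move=> U2 UV.
(* The factors are taken in the order [U p.2 * U p.1] because the trace of [A *m V] pairs [A a b]
   with [V b a]. *)
pose g (p : 'I_n * 'I_n) : T -> R := A p.1 p.2 \o* (U p.2 * U p.1).
have U1 a b : U a * U b \in Lfun Pr 1 by apply: Lfun2_mul_Lfun1.
rewrite [X in 'E_Pr[X]%E](_ : _ =
  \sum_(h <- [seq g p | p <- enum {: 'I_n * 'I_n}]) h).
  rewrite expectation_sum => [|_ /mapP[p _ ->]]; last exact: Lfun_scale.
  rewrite big_map big_enum /=.
  under eq_bigr do rewrite expectationZl // UV -EFinM.
  rewrite sumEFin /mxtrace; congr EFin; under [RHS]eq_bigr do rewrite mxE.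
  by rewrite pair_bigA.
apply/funext => t; rewrite big_map big_enum /= fct_sumE mxE.
under eq_bigr do rewrite !mxE mulr_suml.
rewrite exchange_big pair_bigA /=; apply: eq_bigr => -[a b] _ /=.
by rewrite !mxE /g /= !fctE; ring.
Qed.

Lemma covariance_centered (X Y : T -> R) :
  X \in Lfun Pr 2%:E -> Y \in Lfun Pr 2%:E -> ('E_Pr[X] = 0)%E ->
  covariance Pr X Y = ('E_Pr[X * Y])%E.
Proof.
move=> X2 Y2 X0; rewrite covarianceE ?X0 ?mul0e ?sube0 //.
- exact: Lfun2_Lfun1.
- exact: Lfun2_Lfun1.
- exact: Lfun2_mul_Lfun1.
Qed.

Lemma independent_vectors_expectation (S S' : finType)
    (X : S -> {RV Pr >-> R}) (Y : S' -> {RV Pr >-> R}) s s' :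
  independent_vectors X Y ->
  (X s : T -> R) \in Lfun Pr 2%:E -> (Y s' : T -> R) \in Lfun Pr 2%:E ->
  ('E_Pr[(X s : T -> R) * (Y s' : T -> R)] = 'E_Pr[X s] * 'E_Pr[Y s'])%E.
Proof.
move=> indXY X2 Y2; apply: expectation_mul_indep.
- exact: Lfun2_Lfun1.
- exact: Lfun2_Lfun1.
- exact: Lfun2_mul_Lfun1.
(* The preimage of a measurable set under one coordinate is a generator of the sigma-algebra of the
   vector. *)
move=> A B mA mB; apply: indXY; apply: sub_sigma_algebra.
  by exists s, A => //; rewrite setTI.
by exists s', B => //; rewrite setTI.
Qed.

(** Expanding the product gives four terms. The two mixed ones vanish by independence and zero
    means; the other two are covariances, and the design matrices merely read [VW] at the images
    under [f]. *)
Lemma second_moment_response (Om Up : finType) (f : Om -> Up)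
    (Z : Om -> {RV Pr >-> R}) (W : Up -> {RV Pr >-> R})
    (VZ : 'M[R]_#|Om|) (VW : 'M[R]_#|Up|) (a b : 'I_#|Om|) :
  independent_vectors Z W -> mean_zero Z -> mean_zero W ->
  has_covariance_mx Z VZ -> has_covariance_mx W VW ->
  let U c : T -> R :=
    (Z (enum_val c) : T -> R) + (W (f (enum_val c)) : T -> R) in
  ('E_Pr[U a * U b] =
   ((VZ + design_mx R f *m VW *m (design_mx R f)^T) a b)%:E)%E.
Proof.
move=> indZW Z0 W0 [Z2 covZ] [W2 covW] U.
have -> : (VZ + design_mx R f *m VW *m (design_mx R f)^T) a b =
    VZ a b + VW (enum_rank (f (enum_val a))) (enum_rank (f (enum_val b))).
  rewrite mxE -mulmxA design_mx_mulE -[_ *m _^T]trmxK trmx_mul trmxK mxE.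
  by rewrite design_mx_mulE mxE.
rewrite /U mulrDl !mulrDr.
have ZZ1 s s' : (Z s : T -> R) * (Z s' : T -> R) \in Lfun Pr 1.
  exact: Lfun2_mul_Lfun1.
have ZW1 s s' : (Z s : T -> R) * (W s' : T -> R) \in Lfun Pr 1.
  exact: Lfun2_mul_Lfun1.
have WZ1 s s' : (W s : T -> R) * (Z s' : T -> R) \in Lfun Pr 1.
  exact: Lfun2_mul_Lfun1.
have WW1 s s' : (W s : T -> R) * (W s' : T -> R) \in Lfun Pr 1.
  exact: Lfun2_mul_Lfun1.
have ZWE s s' : ('E_Pr[(Z s : T -> R) * (W s' : T -> R)] = 0)%E.
  by rewrite independent_vectors_expectation // Z0 mul0e.
rewrite !expectationD ?rpredD //.
have WZE s s' : ('E_Pr[(W s : T -> R) * (Z s' : T -> R)] = 0)%E.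
  by rewrite mulrC ZWE.
rewrite ZWE WZE -!covariance_centered // covZ covW.
by rewrite adde0 add0e !enum_valK EFinD.
Qed.

End SecondMoments.

(** * Expected mean square of the residual projector *)

Theorem mainTheorem2 (R : realType)
    (Om Up Ga : finType) (f : Om -> Up) (h : Up -> Ga) (r : nat)
    (f_surj : surjective f) (h_surj : surjective h)
    (f_rep : equireplicate f r)
    (* the set of P's: stratum projectors of G1 *)
    (G1 : {group {perm Om}})
    (G1_trans : transitive_perm_group G1)
    (G1_strat : stratifiable R G1)
    (IP : finType) (P : IP -> 'M[R]_#|Om|)
    (P_strata : stratum_projectors G1 P)
    (* the set of Q's: from (a refinement of) the stratum projectors of G2 *)
    (G2 : {group {perm Up}})
    (G2_trans : transitive_perm_group G2)
    (G2_strat : stratifiable R G2)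
    (IS : finType) (SU : IS -> 'M[R]_#|Up|)
    (SU_strata : stratum_projectors G2 SU)
    (IQ : finType) (s : IQ -> IS) (QU : IQ -> 'M[R]_#|Up|)
    (QU_ref : refinement SU s QU)
    (* the set of R's *)
    (IR : finType) (RU : IR -> 'M[R]_#|Up|)
    (RU_idem : forall k, RU k != 0 /\ symm_idempotent (RU k))
    (RU_orth : mutually_orthogonal RU)
    (RU_sum : \sum_k RU k = design_proj R h)
    (* structure balance *)
    (lamPQ : IP -> IQ -> R) (lamQR : IQ -> IR -> R)
    (balPQ : structure_balanced P (fun j => lift_mx f r (QU j)) lamPQ)
    (balQR : structure_balanced (fun j => lift_mx f r (QU j))
                                (fun k => lift_mx f r (RU k)) lamQR)
    (* model *)
    (d : measure_display) (T : measurableType d) (Pr : probability T R)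
    (xi : IP -> R) (eta : IQ -> R)
    (xi_ge0 : forall i, 0 <= xi i) (eta_ge0 : forall j, 0 <= eta j)
    (eta_ref : forall j j', s j = s j' -> eta j = eta j')
    (Z : Om -> {RV Pr >-> R}) (W : Up -> {RV Pr >-> R})
    (tau : 'cV[R]_#|Ga|)
    (ZW_indep : independent_vectors Z W)
    (Z_mean : mean_zero Z) (W_mean : mean_zero W)
    (Z_cov : has_covariance_mx Z (\sum_i xi i *: P i))
    (W_cov : has_covariance_mx W (\sum_j eta j *: QU j))
    (* conclusion *)
    (i : IP) (j : IQ) (lam_neq0 : lamPQ i j != 0)
    (A := residual (lamPQ i j) (P i) (lift_mx f r (QU j))
                   (lamQR j) (fun k => lift_mx f r (RU k)))
    (A_neq0 : A != 0) :
  expected_mean_square Pr A (response f h Z W tau) =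
    (xi i + r%:R * lamPQ i j * eta j)%:E.
Proof.
(* An element of [Om] makes some fibre nonempty. If [Om] is empty, [A] has size 0 and must vanish,
   against [A_neq0]. *)
have r_gt0 : (0 < r)%N.
  have [x _|Om0] := pickP (@predT Om).
    by rewrite -(f_rep (f x)); apply/card_gt0P; exists x; rewrite inE.
  case/eqP: A_neq0; apply/matrixP => a; have := ltn_ord a.
  by rewrite [X in (_ < X)%N]eq_card0.
have r_neq0 : r%:R != 0 :> R by rewrite pnatr_eq0 -lt0n.
have liftM (B C : 'M[R]_#|Up|) :
    lift_mx f r B *m lift_mx f r C = lift_mx f r (B *m C).
  exact: lift_mxM.
set Q := fun j => lift_mx f r (QU j) in balPQ balQR.
set Rm := fun k => lift_mx f r (RU k) in balQR A A_neq0 *.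
rewrite -[lift_mx f r (QU j)]/(Q j) in A A_neq0 *.
have [QU_idem _ _ _] := QU_ref.
have QU_orth : mutually_orthogonal QU.
  exact/(refinement_orthogonal QU_ref)/strata_orthogonal/SU_strata.
have QU_sum : \sum_j QU j = 1%:M.
  by rewrite (refinement_sum QU_ref) (strata_sum G2_strat SU_strata).
have P_orth := strata_orthogonal P_strata.
have [P_sym P_idem] : symm_idempotent (P i).
  have [_ [chi []]] // : stratum_projector G1 (P i).
  by apply/(proj2 P_strata); exists i.
have Q_sym : (Q j)^T = Q j by rewrite /Q trmx_lift (proj1 (proj2 (QU_idem j))).
have Q_idem j' : Q j' *m Q j' = Q j'.
  by rewrite /Q liftM (proj2 (proj2 (QU_idem j'))).
have Q_orth j1 j2 : j1 != j2 -> Q j1 *m Q j2 = 0.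
  by move=> neq; rewrite /Q liftM QU_orth // lift_mx0.
have R_sym k : (Rm k)^T = Rm k.
  by rewrite /Rm trmx_lift (proj1 (proj2 (RU_idem k))).
have R_idem k : Rm k *m Rm k = Rm k.
  by rewrite /Rm liftM (proj2 (proj2 (RU_idem k))).
have R_orth k1 k2 : k1 != k2 -> Rm k1 *m Rm k2 = 0.
  by move=> neq; rewrite /Rm liftM RU_orth // lift_mx0.
(* The [Q]'s sum to the lift of the identity, which fixes every lifted matrix. *)
have R_sub_Q : (\sum_j' Q j') *m (\sum_k Rm k) = \sum_k Rm k.
  by rewrite /Q /Rm -!lift_mx_sum liftM QU_sum mul1mx.
have A_sym : A^T = A by apply: residual_sym.
have A_idem : A *m A = A by apply: (residual_idem (lam := lamPQ i)).
have AP : A *m P i = A by apply: residual_mulP.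
have AQ j' : j' != j -> A *m Q j' = 0.
  by apply: (residual_mulQ (lam := lamPQ i)).
have trAQ : \tr (A *m Q j) = lamPQ i j * \tr A.
  by apply: (mxtrace_residual_mulQ (lam := lamPQ i)).
have AR : A *m (\sum_k Rm k) = 0 by apply: (residual_mulR (lam := lamPQ i)).
have rankA_neq0 : (\rank A)%:R != 0 :> R by rewrite pnatr_eq0 mxrank_eq0.
set m := design_mx R f *m design_mx R h *m tau.
(* The treatment means are fixed by the sum of the [R]'s, the lift of the projector onto the columns
   of the design matrix of [h]. *)
have Am : A *m m = 0.
  suff <- : (\sum_k Rm k) *m m = m by rewrite mulmxA AR mul0mx.
  rewrite /m -mulmxA /Rm -lift_mx_sum lift_mx_design // RU_sum.
  by rewrite [design_proj _ _ *m _]mulmxA design_proj_mul.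
have quadE u : (u + m)^T *m A *m (u + m) = u^T *m A *m u.
  have mA : m^T *m A = 0.
    by apply: trmx_inj; rewrite trmx_mul trmxK A_sym Am trmx0.
  rewrite mulmxDr -(mulmxA _ A m) Am mulmx0 addr0.
  by rewrite [(u + m)^T]linearD /= (mulmxDl u^T) mA addr0.
pose U (c : 'I_#|Om|) : T -> R :=
  (Z (enum_val c) : T -> R) + (W (f (enum_val c)) : T -> R).
pose V := \sum_k xi k *: P k +
  design_mx R f *m (\sum_j eta j *: QU j) *m (design_mx R f)^T.
have mean_squareE : mean_square A (response f h Z W tau) =
    fun t => ((\col_a U a t)^T *m ((\rank A)%:R^-1 *: A) *m
              (\col_a U a t)) ord0 ord0.
  apply/funext => t; rewrite /mean_square /response -/m.
  have -> : random_col Z t + design_mx R f *m random_col W t = \col_a U a t.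
    by apply/colP => a; rewrite mxE design_mx_mulE !mxE enum_rankK.
  by rewrite quadE -scalemxAr -scalemxAl [RHS]mxE mulrC.
rewrite /expected_mean_square mean_squareE.
rewrite (@expectation_qform _ _ _ _ _ _ V); last 2 first.
- move=> a; apply: rpredD => [|le12|le12]; first by rewrite lee1n.
    exact: (proj1 Z_cov).
  exact: (proj1 W_cov).
- by move=> a b; apply: second_moment_response.
congr EFin; rewrite -scalemxAl mxtraceZ.
(* For an idempotent the trace is the rank, so the normalization by the rank leaves only the
   coefficient. *)
suff -> : \tr (A *m V) = (xi i + r%:R * lamPQ i j * eta j) * \tr A.
  by rewrite mxtrace_idem // mulrC mulfK.
(* The factor [r] appears because each [Q j] carries the [r^-1] of the lift. *)
have -> : V = \sum_k xi k *: P k + r%:R *: \sum_j eta j *: Q j.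
  congr (_ + _); rewrite mulmx_sumr mulmx_suml scaler_sumr.
  apply: eq_bigr => j' _.
  by rewrite -scalemxAr -scalemxAl /Q /lift_mx !scalerA; congr (_ *: _); field.
rewrite mulmxDr mxtraceD -scalemxAr mxtraceZ mulrDl; congr (_ + _).
  rewrite mulmx_sumr (bigD1 i) //= big1 => [|k neq_k]; last first.
    (* For [k != i], [A *m P k] equals [A *m P i *m P k], which is zero. *)
    by rewrite -AP -scalemxAr -mulmxA P_orth ?mulmx0 ?scaler0 // eq_sym.
  by rewrite addr0 -scalemxAr AP mxtraceZ.
rewrite mulmx_sumr (bigD1 j) //= big1 => [|j' neq_j]; last first.
  by rewrite -scalemxAr AQ ?scaler0.
by rewrite addr0 -scalemxAr mxtraceZ trAQ; ring.
Qed.
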